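(* Let $p,q,n$ be positive integers, let $\mu\in\mathbb{R}^{pq}$, and let $\Gamma\in\mathcal{M}_{p,p}(\mathbb{R})$ and $\Psi\in\mathcal{M}_{q,q}(\mathbb{R})$ be symmetric positive definite matrices ($\mu,\Gamma,\Psi$ unknown). Let $X_1,\ldots,X_n$ be independent random matrices in $\mathcal{M}_{p,q}(\mathbb{R})$ with $\mathrm{vec}(X_k)\sim\mathcal{N}(\mu,\Psi\otimes\Gamma)$ for $k=1,\ldots,n$. If $n>pq$, then the maximum likelihood estimator of $\Psi\otimes\Gamma$ exists with probability $1$.
   Context: $\mathcal{M}_{p,q}(\mathbb{R})$ is the set of real $p\times q$ matrices, $\mathrm{vec}$ stacks the columns of a matrix into one vector, and $\otimes$ is the Kronecker product. The likelihood function, for $M\in\mathcal{M}_{p,q}(\mathbb{R})$ (with $\mathrm{vec}(M)$ the mean vector) and symmetric positive definite $\Gamma\in\mathcal{M}_{p,p}(\mathbb{R})$, $\Psi\in\mathcal{M}_{q,q}(\mathbb{R})$, is $$L(M,\Gamma,\Psi)=(2\pi)^{-\frac12 pqn}|\Gamma|^{-\frac12 qn}|\Psi|^{-\frac12 pn}\exp\Big(-\tfrac12\,\mathrm{trace}\Big(\Psi^{-1}\sum_{k=1}^n (X_k-M)^T\Gamma^{-1}(X_k-M)\Big)\Big),$$ where $|A|$ is the determinant of $A$. It depends on $(\Gamma,\Psi)$ only through $\Psi\otimes\Gamma$. A maximum likelihood estimator of $\Psi\otimes\Gamma$ is a matrix $\hat\Psi\otimes\hat\Gamma$ with $\hat\Gamma,\hat\Psi$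 symmetric positive definite such that $L$ attains its global maximum, over all $M\in\mathcal{M}_{p,q}(\mathbb{R})$ and all symmetric positive definite $\Gamma,\Psi$, at $(\hat M,\hat\Gamma,\hat\Psi)$, where $\hat M=\frac1n\sum_{k=1}^n X_k$. The estimator exists if at least one such matrix exists. *)

(* Defs.v *)
From HB Require Import structures.
From mathcomp Require Import all_boot all_order all_algebra.
From mathcomp Require Import mxtens.
From mathcomp Require Import all_classical all_reals all_analysis.

Set Implicit Arguments.
Unset Strict Implicit.
Unset Printing Implicit Defensive.

Import Order.TTheory GRing.Theory Num.Theory.
Import numFieldNormedType.Exports.

Local Open Scope classical_set_scope.
Local Open Scope ring_scope.

Definition posdefmx (R : realType) (m : nat) (A : 'M[R]_m) : Prop :=
  A^T = A /\ forall v : 'cV[R]_m, v != 0 -> 0 < (v^T *m A *m v) 0 0.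

(* Row [k = j * p + i] of [vec A], with [i < p], is [A i j]: [mxtens_unindex k]
   is [(k %/ p, k %% p)], the indexing of the Kronecker product [tensmx]. *)
Definition vec (R : realType) (p q : nat) (A : 'M[R]_(p, q)) : 'cV[R]_(q * p) :=
  \col_k A (mxtens_unindex k).2 (mxtens_unindex k).1.

(* The sigma-algebra on matrices generated by the entries, which is the Borel
   one. *)
Definition borel_mx (R : realType) (p q : nat) : set_system 'M[R]_(p, q) :=
  <<s [set A : set 'M[R]_(p, q) | exists (i : 'I_p) (j : 'I_q),
         exists2 B : set R, measurable B &
         A = [set M : 'M[R]_(p, q) | B (M i j)]] >>.

Definition random_mx d (T : measurableType d) (R : realType) (p q : nat)
    (X : T -> 'M[R]_(p, q)) : Prop :=
  forall B, borel_mx B -> measurable (X @^-1` B).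

Definition independent_mx d (T : measurableType d) (R : realType)
    (P : probability T R) (n p q : nat) (X : 'I_n -> T -> 'M[R]_(p, q)) : Prop :=
  forall (B : 'I_n -> set 'M[R]_(p, q)) (J : {set 'I_n}),
    (forall k, borel_mx (B k)) ->
    P (\bigcap_(k in [set` J]) (X k @^-1` B k)) =
    (\prod_(k in J) P (X k @^-1` B k))%E.

(* Integral over [R^N] against Lebesgue measure, as an iterated integral. It is
   only used on nonnegative Borel functions, where this is Tonelli's theorem. *)
Fixpoint integral_cV (R : realType) (N : nat) :
    ('cV[R]_N -> \bar R) -> \bar R :=
  match N return ('cV[R]_N -> \bar R) -> \bar R with
  | 0 => fun f => f 0
  | m.+1 => fun f =>
      (\int[lebesgue_measure]_(x in [set: R])
         integral_cV (fun v : 'cV[R]_m =>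
           f (col_mx (x%:M : 'M[R]_1) v : 'cV[R]_m.+1)))%E
  end.

Definition mvn_pdf (R : realType) (N : nat) (mu : 'cV[R]_N) (Sigma : 'M[R]_N)
    (y : 'cV[R]_N) : R :=
  (2 * pi) `^ (- (N%:R / 2)) * (\det Sigma) `^ (- (1 / 2)) *
  expR (- (1 / 2) * ((y - mu)^T *m invmx Sigma *m (y - mu)) 0 0).

(* [Y ~ N(mu, Sigma)] for a positive definite [Sigma]. *)
Definition multivariate_normal d (T : measurableType d) (R : realType)
    (P : probability T R) (N : nat) (Y : T -> 'cV[R]_N)
    (mu : 'cV[R]_N) (Sigma : 'M[R]_N) : Prop :=
  random_mx Y /\
  forall B : set 'cV[R]_N, borel_mx B ->
    P (Y @^-1` B) = integral_cV (fun y => (mvn_pdf mu Sigma y * \1_B y)%:E).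

Definition likelihood (R : realType) (p q n : nat) (X : 'I_n -> 'M[R]_(p, q))
    (M : 'M[R]_(p, q)) (G : 'M[R]_p) (Psi : 'M[R]_q) : R :=
  (2 * pi) `^ (- ((p * q * n)%:R / 2)) *
  (\det G) `^ (- ((q * n)%:R / 2)) *
  (\det Psi) `^ (- ((p * n)%:R / 2)) *
  expR (- (1 / 2) *
    \tr (invmx Psi *m \sum_(k < n) ((X k - M)^T *m invmx G *m (X k - M)))).

Definition sample_mean (R : realType) (p q n : nat)
    (X : 'I_n -> 'M[R]_(p, q)) : 'M[R]_(p, q) :=
  n%:R^-1 *: \sum_(k < n) X k.

Definition is_mle_kron (R : realType) (p q n : nat) (X : 'I_n -> 'M[R]_(p, q))
    (K : 'M[R]_(q * p)) : Prop :=
  exists (G : 'M[R]_p) (Psi : 'M[R]_q),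
    [/\ posdefmx G, posdefmx Psi, K = tensmx Psi G &
        forall (M' : 'M[R]_(p, q)) (G' : 'M[R]_p) (Psi' : 'M[R]_q),
          posdefmx G' -> posdefmx Psi' ->
          likelihood X M' G' Psi' <= likelihood X (sample_mean X) G Psi].

(* Main.v *)
(* Deterministic part: write [G^-1 = U^T U] and [Psi^-1 = V^T V]. With
   [Y_k = X_k - mean], [m = p q n] and [g = \sum_k |U Y_k V^T|^2], the likelihood at
   the optimal mean is, up to a constant, [|det U|^(q n) |det V|^(p n) exp(- g / 2)].
   If the [Y_k] span the space of matrices then [g > 0], and the quotient
   [(|det U|^(q n) |det V|^(p n))^2 / g^m] is homogeneous of degree 0 in [U] and in
   [V], hence attains its maximum on the product of the two unit spheres. Rescaling
   a maximizer so that [g = m] gives the estimator, since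
   [g^m exp(- g) <= m^m exp(- m)].

   Probabilistic part: with [N = p q], the [Y_k] span as soon as the vectors
   [(1, vec X_k)], [k <= N], are linearly independent. Put them one by one into the
   rows of the identity matrix of size [1 + N]: given the previous ones, the new
   determinant is a nonzero affine function of [vec X_k], and a nondegenerate normal
   law does not charge a proper affine subspace. *)

Require Import Defs.
From mathcomp Require Import all_boot all_order all_algebra.
From mathcomp Require Import mxtens.
From mathcomp Require Import all_classical all_reals all_analysis.
From mathcomp Require Import measurable_realfun ring lra.

Set Implicit Arguments.
Unset Strict Implicit.
Unset Printing Implicit Defensive.

Import Order.TTheory GRing.Theory Num.Theory.
Import numFieldNormedType.Exports.

Local Open Scope classical_set_scope.
Local Open Scope ring_scope.

(** * Squared Frobenius norm *)

Definition sqnorm (R : realType) (m n : nat) (A : 'M[R]_(m, n)) : R :=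
  \tr (A^T *m A).

Lemma sqnormE (R : realType) (m n : nat) (A : 'M[R]_(m, n)) :
  sqnorm A = \sum_i \sum_j A i j ^+ 2.
Proof.
rewrite /sqnorm /mxtrace exchange_big /=; apply: eq_bigr => j _.
by rewrite mxE; apply: eq_bigr => i _; rewrite mxE expr2.
Qed.

Lemma sqnorm_ge0 (R : realType) (m n : nat) (A : 'M[R]_(m, n)) : 0 <= sqnorm A.
Proof. by rewrite sqnormE; do 2 apply: sumr_ge0 => ? _; rewrite sqr_ge0. Qed.

Lemma sqnorm_eq0 (R : realType) (m n : nat) (A : 'M[R]_(m, n)) :
  (sqnorm A == 0) = (A == 0).
Proof.
apply/eqP/eqP => [|->]; last by rewrite /sqnorm mulmx0 mxtrace0.
rewrite sqnormE => A0; apply/matrixP => i j; rewrite mxE.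
have h0 i' : 0 <= \sum_j A i' j ^+ 2 by apply: sumr_ge0 => ? _; rewrite sqr_ge0.
have Ai0 : \sum_j A i j ^+ 2 = 0 by apply: (psumr_eq0P _ A0) => // i' _.
apply/eqP; rewrite -(sqrf_eq0 (A i j)); apply/eqP.
by apply: (psumr_eq0P _ Ai0) => // j' _; exact: sqr_ge0.
Qed.

Lemma sqnorm_gt0 (R : realType) (m n : nat) (A : 'M[R]_(m, n)) :
  (0 < sqnorm A) = (A != 0).
Proof. by rewrite lt0r sqnorm_eq0 sqnorm_ge0 andbT. Qed.

Lemma sqnormZ (R : realType) (m n : nat) (a : R) (A : 'M[R]_(m, n)) :
  sqnorm (a *: A) = a ^+ 2 * sqnorm A.
Proof.
rewrite !sqnormE mulr_sumr; apply: eq_bigr => i _; rewrite mulr_sumr.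
by apply: eq_bigr => j _; rewrite mxE exprMn.
Qed.

(** * Gram factorization of positive definite matrices *)

Lemma invmxM (R : comUnitRingType) (m : nat) (A B : 'M[R]_m) :
  A \in unitmx -> B \in unitmx -> invmx (A *m B) = invmx B *m invmx A.
Proof.
move=> uA uB; have uAB : A *m B \in unitmx by rewrite unitmx_mul uA.
apply: (can_inj (mulKmx uAB)); rewrite mulmxV //.
by rewrite mulmxA -(mulmxA A) mulmxV // mulmx1 mulmxV.
Qed.

(* Induction on the size: with [A = [a, b; b^T, D]], the Schur complement
   [D - b^T b / a] is again positive definite. *)
Lemma cholesky (R : realType) (m : nat) (A : 'M[R]_m) :
  posdefmx A -> exists2 W : 'M[R]_m, W \in unitmx & A = W *m W^T.
Proof.
elim: m A => [|m IH] A [symA posA].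
  by exists 1%:M; [rewrite unitmx1 | apply/matrixP => -[]].
move: A symA posA; change m.+1 with (1 + m)%N => A.
rewrite -[A]submxK; set a := ulsubmx A; set b := ursubmx A.
set b' := dlsubmx A; set D := drsubmx A; rewrite tr_block_mx.
move=> /eq_block_mx[_ b'E _ DE] posA.
have {}b'E : b' = b^T by rewrite -b'E trmxK.
rewrite {}b'E {b'} in posA *.
have aE : a = (a 0 0)%:M by rewrite [LHS]mx11_scalar.
have a_gt0 : 0 < a 0 0.
  have := posA (col_mx 1%:M 0).
  rewrite tr_col_mx mul_row_block mul_row_col !trmx0 !mul0mx !mulmx0 !addr0.
  rewrite trmx1 mul1mx mulmx1; apply; rewrite col_mx_eq0 negb_and.
  by apply/orP; left; apply/eqP => /matrixP /(_ 0 0) /eqP; rewrite !mxE oner_eq0.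
set al := a 0 0 in aE a_gt0 *.
have [|W uW DW] := IH (D - al^-1 *: (b^T *m b)).
  split; first by rewrite linearB linearZ /= trmx_mul trmxK DE.
  (* For fixed [v], this upper entry minimizes the quadratic form, and the minimum is the form of
     the Schur complement at [v]. *)
  move=> v v0; have := posA (col_mx (- (al^-1 *: (b *m v))) v).
  have -> : col_mx (- (al^-1 *: (b *m v))) v != 0.
    by apply: contra v0; rewrite col_mx_eq0 => /andP[_].
  move=> /(_ isT); congr (_ < _); congr (_ 0 0).
  rewrite tr_col_mx mul_row_block mul_row_col aE.
  have -> : (- (al^-1 *: (b *m v)))^T = - (al^-1 *: (v^T *m b^T)).
    by rewrite linearN linearZ /= trmx_mul.
  rewrite mulNmx -scalemxAl mul_mx_scalar scalerA.
  rewrite mulVf ?gt_eqF // scale1r addNr mul0mx add0r mulNmx -scalemxAl.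
  by rewrite mulmxBr mulmxBl addrC mulmxDl mulNmx -scalemxAr -!scalemxAl !mulmxA.
exists (block_mx (Num.sqrt al)%:M 0 ((Num.sqrt al)^-1 *: b^T) W).
  rewrite unitmxE det_lblock det_scalar expr1 unitrM -unitmxE uW andbT.
  by rewrite unitfE gt_eqF // sqrtr_gt0.
have sE : Num.sqrt al * Num.sqrt al = al by rewrite -expr2 sqr_sqrtr // ltW.
have s0 : Num.sqrt al != 0 by rewrite gt_eqF // sqrtr_gt0.
rewrite tr_block_mx mulmx_block trmx0 !mul0mx !mulmx0 !addr0.
rewrite tr_scalar_mx -scalar_mxM sE -aE linearZ /= trmxK mul_scalar_mx scalerA.
rewrite mulfV // scale1r mul_mx_scalar scalerA mulfV // scale1r.
by rewrite -scalemxAl -scalemxAr scalerA -DW -invfM sE addrC subrK.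
Qed.

(** The quadratic form at [v] is the squared norm of [(invmx U)^T *m v]. Together with
    [posdefmx_factor], this parametrizes positive definite matrices by invertible ones. *)
Lemma posdefmx_gram (R : realType) (m : nat) (U : 'M[R]_m) :
  U \in unitmx -> posdefmx (invmx (U^T *m U)).
Proof.
move=> uU; have -> : invmx (U^T *m U) = invmx U *m (invmx U)^T.
  by rewrite invmxM ?unitmx_tr // trmx_inv.
split; first by rewrite trmx_mul trmxK.
move=> v v0; rewrite mulmxA -mulmxA -[v^T *m _]trmxK trmx_mul trmxK.
set w := _ *m v; have -> : (w^T *m w) 0 0 = sqnorm w by rewrite /sqnorm [RHS]trace_mx11.
rewrite sqnorm_gt0; apply: contra v0 => /eqP w0.
have uUt : (invmx U)^T \in unitmx by rewrite unitmx_tr unitmx_inv.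
by rewrite -(mulKmx uUt v) -/w w0 mulmx0.
Qed.

Lemma posdefmx_factor (R : realType) (m : nat) (G : 'M[R]_m) :
  posdefmx G -> exists2 U : 'M[R]_m, U \in unitmx & G = invmx (U^T *m U).
Proof.
move=> /cholesky[W uW ->]; exists (invmx W); first by rewrite unitmx_inv.
by rewrite invmxM ?unitmx_tr ?unitmx_inv // invmxK -trmx_inv invmxK.
Qed.

(** * The likelihood in Gram factors *)

Lemma powR_invsqr (R : realType) (x : R) (m : nat) :
  x != 0 -> ((x ^+ 2)^-1) `^ (- (m%:R / 2)) = `|x| ^+ m.
Proof.
move=> x0; have nx0 : 0 <= `|x| by [].
have -> : (x ^+ 2)^-1 = `|x| `^ (- 2%:R).
  by rewrite powRN powR_mulrn // real_normK ?num_real.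
by rewrite -powRrM mulrNN mulrC divfK ?pnatr_eq0 // powR_mulrn.
Qed.

Lemma det_invgram (R : realType) (m : nat) (U : 'M[R]_m) :
  \det (invmx (U^T *m U)) = (\det U ^+ 2)^-1.
Proof. by rewrite det_inv det_mulmx det_tr expr2. Qed.

(** Cyclicity of the trace turns each summand of the exponent into a squared norm, and the
    half-integer powers of determinants become integer powers of absolute values. *)
Lemma likelihood_gram (R : realType) (p q n : nat) (X : 'I_n -> 'M[R]_(p, q))
    (M : 'M[R]_(p, q)) (U : 'M[R]_p) (V : 'M[R]_q) :
  U \in unitmx -> V \in unitmx ->
  likelihood X M (invmx (U^T *m U)) (invmx (V^T *m V)) =
  (2 * pi) `^ (- ((p * q * n)%:R / 2)) *
  (`|\det U| ^+ (q * n) * `|\det V| ^+ (p * n) *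
   expR (- (1 / 2) * \sum_(k < n) sqnorm (U *m (X k - M) *m V^T))).
Proof.
move=> uU uV; have dU : \det U != 0 by rewrite -unitfE -unitmxE.
have dV : \det V != 0 by rewrite -unitfE -unitmxE.
rewrite /likelihood !det_invgram !powR_invsqr // !invmxK -!mulrA.
congr (_ * (_ * (_ * expR (_ * _)))).
rewrite mulmx_sumr raddf_sum /=; apply: eq_bigr => k _.
by rewrite /sqnorm !trmx_mul trmxK -!mulmxA mxtrace_mulC !mulmxA.
Qed.

(** * Optimality of the sample mean, and a scalar inequality *)

Lemma sum_sub_sample_mean (R : realType) (p q n : nat)
    (X : 'I_n -> 'M[R]_(p, q)) :
  (0 < n)%N -> \sum_(k < n) (X k - sample_mean X) = 0.
Proof.
move=> n0; rewrite sumrB sumr_const card_ord /sample_mean -scaler_nat scalerA.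
by rewrite mulfV ?scale1r ?subrr // pnatr_eq0 -lt0n.
Qed.

Lemma sqnormD (R : realType) (m n : nat) (A B : 'M[R]_(m, n)) :
  sqnorm (A + B) = sqnorm A + sqnorm B + 2 * \tr (A^T *m B).
Proof.
have -> : sqnorm (A + B) = \tr ((A^T + B^T) *m (A + B)) by rewrite /sqnorm !linearD.
rewrite mulmxDl !mulmxDr !mxtraceD -[\tr (B^T *m A)]mxtrace_tr trmx_mul trmxK.
rewrite /sqnorm; ring.
Qed.

(** Expanding around the sample mean, the cross terms sum to zero because the deviations do; what
    remains to be added is a sum of squared norms. *)
Lemma sample_mean_min (R : realType) (p q n : nat) (X : 'I_n -> 'M[R]_(p, q))
    (M : 'M[R]_(p, q)) (U : 'M[R]_p) (V : 'M[R]_q) :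
  (0 < n)%N ->
  \sum_(k < n) sqnorm (U *m (X k - sample_mean X) *m V^T) <=
  \sum_(k < n) sqnorm (U *m (X k - M) *m V^T).
Proof.
move=> n0; set D := U *m (sample_mean X - M) *m V^T.
have E k : sqnorm (U *m (X k - M) *m V^T) =
    sqnorm (U *m (X k - sample_mean X) *m V^T) + sqnorm D +
    2 * \tr ((U *m (X k - sample_mean X) *m V^T)^T *m D).
  by rewrite -sqnormD /D -mulmxDl -mulmxDr addrA subrK.
rewrite (eq_bigr _ (fun k _ => E k)) 2!big_split /= -addrA lerDl.
have -> : \sum_(k < n) 2 * \tr ((U *m (X k - sample_mean X) *m V^T)^T *m D) = 0.
  rewrite -mulr_sumr -[\sum_(i < n) _]raddf_sum /= -mulmx_suml.
  rewrite -[\sum_(i < n) _]raddf_sum /= -mulmx_suml -mulmx_sumr.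
  by rewrite sum_sub_sample_mean // mulmx0 mul0mx trmx0 mul0mx mxtrace0 mulr0.
rewrite addr0.
by apply: sumr_ge0 => k _; exact: sqnorm_ge0.
Qed.

(** This is [t <= expR (t - 1)] at [t = g / m], raised to the power [m]. *)
Lemma expR_power_le (R : realType) (m : nat) (g : R) :
  (0 < m)%N -> 0 <= g -> g ^+ m * expR (- g) <= m%:R ^+ m * expR (- m%:R).
Proof.
move=> m0 g0; have m0' : (0 : R) < m%:R by rewrite ltr0n.
have h : g / m%:R <= expR (g / m%:R - 1).
  by apply: le_trans (expR_ge1Dx _); rewrite addrC subrK.
have : (g / m%:R) ^+ m <= expR (g / m%:R - 1) ^+ m.
  by rewrite lerXn2r // nnegrE ?expR_ge0 // divr_ge0 // ltW.
rewrite -expRM_natl.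
have -> : m%:R * (g / m%:R - 1) = g - m%:R by field; rewrite gt_eqF.
rewrite exprMn exprVn ler_pdivrMr ?exprn_gt0 // expRD => H.
rewrite [expR (- g)]expRN ler_pdivrMr ?expR_gt0 // (le_trans H) //.
by rewrite le_eqVlt; apply/orP; left; apply/eqP; ring.
Qed.

(** * Continuity of matrix functions and compactness of unit spheres *)

Lemma continuous_sumr (R : realType) (T : topologicalType) (I : finType)
    (P : pred I) (F : I -> T -> R) :
  (forall i, continuous (F i)) -> continuous (fun t => \sum_(i | P i) F i t).
Proof. by move=> cF; apply: continuous_big => //; exact: add_continuous. Qed.

Lemma continuous_prodr (R : realType) (T : topologicalType) (I : finType)
    (P : pred I) (F : I -> T -> R) :
  (forall i, continuous (F i)) -> continuous (fun t => \prod_(i | P i) F i t).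
Proof. by move=> cF; apply: continuous_big => //; exact: mul_continuous. Qed.

Lemma continuous_mulr (R : realType) (T : topologicalType) (f g : T -> R) :
  continuous f -> continuous g -> continuous (fun t => f t * g t).
Proof. by move=> cf cg t; apply: cvgM; [exact: cf|exact: cg]. Qed.

Lemma continuous_expr (R : realType) (T : topologicalType) (k : nat) (f : T -> R) :
  continuous f -> continuous (fun t => f t ^+ k).
Proof.
move=> cf t; apply: (@continuous_comp _ _ _ f (@GRing.exp R ^~ k)).
  exact: cf.
exact: exprn_continuous.
Qed.

Lemma continuous_det (R : realType) (T : topologicalType) (m : nat)
    (F : T -> 'M[R]_m) :
  (forall i j, continuous (fun t => F t i j)) -> continuous (fun t => \det (F t)).
Proof.
move=> cF; apply: continuous_sumr => s; apply: continuous_mulr => [t|].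
  exact: cvg_cst.
exact: continuous_prodr.
Qed.

Lemma continuous_mulmx (R : realType) (T : topologicalType) (m n k : nat)
    (F : T -> 'M[R]_(m, n)) (G : T -> 'M[R]_(n, k)) :
  (forall i j, continuous (fun t => F t i j)) ->
  (forall i j, continuous (fun t => G t i j)) ->
  forall i j, continuous (fun t => (F t *m G t) i j).
Proof.
move=> cF cG i j; under eq_fun do rewrite mxE.
by apply: continuous_sumr => l; exact: continuous_mulr.
Qed.

Lemma continuous_sqnorm (R : realType) (T : topologicalType) (m n : nat)
    (F : T -> 'M[R]_(m, n)) :
  (forall i j, continuous (fun t => F t i j)) ->
  continuous (fun t => sqnorm (F t)).
Proof.
move=> cF; under eq_fun do rewrite sqnormE.
by do 2 apply: continuous_sumr => ?; exact: continuous_expr.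
Qed.

Lemma continuous_vec_mx (R : realType) (m n : nat) (i : 'I_m) (j : 'I_n) :
  continuous (fun w : 'rV[R]_(m * n) => vec_mx w i j).
Proof. by under eq_fun do rewrite mxE; exact: coord_continuous. Qed.

Lemma compact_sphere (R : realType) (m n : nat) :
  compact [set w : 'rV[R]_(m * n) | sqnorm (vec_mx w) = 1].
Proof.
apply: bounded_closed_compact; last first.
  apply: (@preimage_closed _ _ (fun w : 'rV[R]_(m * n) => sqnorm (vec_mx w)) [set 1]).
    move=> x _; apply: continuous_sqnorm; exact: continuous_vec_mx.
  exact: closed_eq.
exists 1; split => // M M1 w /= w1; rewrite (le_trans _ (ltW M1)) //.
rewrite [leLHS]/Num.norm /= mx_normrE; apply/bigmax_leP; split => //= -[i k] _ /=.
rewrite {i}(ord1 i); case/mxvec_indexP: k => i j.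
have -> : w 0 (mxvec_index i j) = vec_mx w i j by rewrite mxE.
rewrite -(@ler_pXn2r _ 2) ?nnegrE // expr1n real_normK ?num_real //.
rewrite -w1 sqnormE (bigD1 i) //= (bigD1 j) //= -addrA lerDl addr_ge0 //.
  by apply: sumr_ge0 => ? _; exact: sqr_ge0.
by apply: sumr_ge0 => ? _; apply: sumr_ge0 => ? _; exact: sqr_ge0.
Qed.

Lemma sqnorm_normalize (R : realType) (m n : nat) (A : 'M[R]_(m, n)) :
  A != 0 -> sqnorm ((Num.sqrt (sqnorm A))^-1 *: A) = 1.
Proof.
move=> A0; rewrite sqnormZ exprVn sqr_sqrtr ?sqnorm_ge0 // mulVf //.
by rewrite sqnorm_eq0.
Qed.

(** * Maximization of the scale-invariant ratio *)

Section MaxRatio.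
Variables (R : realType) (p q n : nat) (Y : 'I_n -> 'M[R]_(p, q)).
Hypotheses (p_gt0 : (0 < p)%N) (q_gt0 : (0 < q)%N).
(** Spanning, phrased as triviality of the orthogonal complement for the trace inner product. *)
Hypothesis Y_span : forall S : 'M[R]_(p, q),
  (forall k, \tr (S^T *m Y k) = 0) -> S = 0.

Definition scatter (U : 'M[R]_p) (V : 'M[R]_q) : R :=
  \sum_(k < n) sqnorm (U *m Y k *m V^T).

Definition detpow (U : 'M[R]_p) (V : 'M[R]_q) : R :=
  `|\det U| ^+ (q * n) * `|\det V| ^+ (p * n).

(* Invariant under separate rescalings of [U] and [V]; up to a constant it is
   the square of the maximum over [s] of the likelihood at [(U, s V)]. *)
Definition ratio (U : 'M[R]_p) (V : 'M[R]_q) : R :=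
  detpow U V ^+ 2 / scatter U V ^+ (p * q * n).

Lemma scatter_ge0 (U : 'M[R]_p) (V : 'M[R]_q) : 0 <= scatter U V.
Proof. by apply: sumr_ge0 => k _; exact: sqnorm_ge0. Qed.

Lemma scatterZ (a b : R) (U : 'M[R]_p) (V : 'M[R]_q) :
  scatter (a *: U) (b *: V) = (a * b) ^+ 2 * scatter U V.
Proof.
rewrite /scatter mulr_sumr; apply: eq_bigr => k _; rewrite -sqnormZ.
by rewrite [(b *: V)^T]linearZ /= -!scalemxAl -!scalemxAr scalerA.
Qed.

Lemma detpowZ (a b : R) (U : 'M[R]_p) (V : 'M[R]_q) :
  detpow (a *: U) (b *: V) = `|a * b| ^+ (p * q * n) * detpow U V.
Proof.
rewrite /detpow !detZ !normrM !normrX !exprMn -!exprM mulnA (mulnA q p n) (mulnC q p).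
ring.
Qed.

Lemma ratioZ (a b : R) (U : 'M[R]_p) (V : 'M[R]_q) :
  a != 0 -> b != 0 -> ratio (a *: U) (b *: V) = ratio U V.
Proof.
move=> a0 b0; rewrite /ratio scatterZ detpowZ [(_ * detpow _ _) ^+ 2]exprMn.
rewrite -exprM (mulnC _ 2) exprM real_normK ?num_real // [(_ * scatter _ _) ^+ _]exprMn.
by rewrite -mulf_div divff ?mul1r // !expf_neq0 // mulf_neq0.
Qed.

(* If [U Y_k V^T = 0] for all [k], then for nonzero rows [u] of [U] and [v] of
   [V] the nonzero matrix [u^T v] is orthogonal to all [Y_k]. *)
Lemma scatter_gt0 (U : 'M[R]_p) (V : 'M[R]_q) :
  U != 0 -> V != 0 -> 0 < scatter U V.
Proof.
move=> U0 V0; rewrite lt0r scatter_ge0 andbT; apply/eqP => sc0.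
have {}sc0 k : U *m Y k *m V^T = 0.
  apply/eqP; rewrite -sqnorm_eq0; apply/eqP.
  by apply: (psumr_eq0P _ sc0) => // k' _; exact: sqnorm_ge0.
have [a [i Uai]] : exists a i, U a i != 0.
  apply/not_existsP => H; case/eqP: U0; apply/matrixP => a i; rewrite mxE.
  by apply/eqP/negPn/negP => Uai; apply: (H a); exists i.
have [b [j Vbj]] : exists b j, V b j != 0.
  apply/not_existsP => H; case/eqP: V0; apply/matrixP => b j; rewrite mxE.
  by apply/eqP/negPn/negP => Vbj; apply: (H b); exists j.
have /matrixP /(_ i j) /eqP : (row a U)^T *m row b V = 0.
  apply: Y_span => k; rewrite trmx_mul trmxK -mulmxA mxtrace_mulC.
  rewrite -row_mul trace_mx11.
  have /matrixP /(_ a b) := sc0 k; rewrite [RHS]mxE => <-; rewrite !mxE.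
  by apply: eq_bigr => l _; rewrite !mxE.
by rewrite mxE big_ord1 !mxE mulf_eq0 (negPf Uai) (negPf Vbj).
Qed.

Lemma unitmx_neq0 (m : nat) (A : 'M[R]_m) : (0 < m)%N -> A \in unitmx -> A != 0.
Proof.
case: m A => // m A _; rewrite unitmxE unitfE; apply: contra => /eqP ->.
by rewrite det0.
Qed.

Lemma detpow_gt0 (U : 'M[R]_p) (V : 'M[R]_q) :
  U \in unitmx -> V \in unitmx -> 0 < detpow U V.
Proof.
by rewrite !unitmxE !unitfE => ? ?; rewrite mulr_gt0 ?exprn_gt0 ?normr_gt0.
Qed.

Lemma ratio_max : (0 < n)%N ->
  exists U0 V0, [/\ U0 \in unitmx, V0 \in unitmx &
    forall U V, U \in unitmx -> V \in unitmx -> ratio U V <= ratio U0 V0].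
Proof.
move=> n_gt0.
pose SU := [set w : 'rV[R]_(p * p) | sqnorm (vec_mx w) = 1].
pose SV := [set w : 'rV[R]_(q * q) | sqnorm (vec_mx w) = 1].
pose f w := ratio (vec_mx w.1 : 'M[R]_p) (vec_mx w.2 : 'M[R]_q).
have nzS m (A : 'M[R]_m) : sqnorm A = 1 -> A != 0.
  by move=> A1; rewrite -sqnorm_gt0 A1.
have cU i j : continuous (fun w : 'rV[R]_(p * p) * 'rV[R]_(q * q) =>
    (vec_mx w.1 : 'M[R]_p) i j).
  move=> w; apply: (@continuous_comp _ _ _ fst (fun w : 'rV[R]_(p * p) => vec_mx w i j)).
    exact: cvg_fst.
  exact: continuous_vec_mx.
have cV i j : continuous (fun w : 'rV[R]_(p * p) * 'rV[R]_(q * q) =>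
    (vec_mx w.2 : 'M[R]_q) i j).
  move=> w; apply: (@continuous_comp _ _ _ snd (fun w : 'rV[R]_(q * q) => vec_mx w i j)).
    exact: cvg_snd.
  exact: continuous_vec_mx.
have cd : continuous (fun w : 'rV[R]_(p * p) * 'rV[R]_(q * q) =>
    detpow (vec_mx w.1) (vec_mx w.2)).
  apply: continuous_mulr; apply: continuous_expr => w; apply: cvg_norm.
    exact: (continuous_det cU).
  exact: (continuous_det cV).
have cs : continuous (fun w : 'rV[R]_(p * p) * 'rV[R]_(q * q) =>
    scatter (vec_mx w.1) (vec_mx w.2)).
  apply: continuous_sumr => k; apply: continuous_sqnorm.
  apply: continuous_mulmx => [|i j]; last by under eq_fun do rewrite mxE; exact: cV.
  by apply: continuous_mulmx => [//|i j w]; exact: cvg_cst.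
(* On the spheres both factors are nonzero, so the denominator stays positive even where they are
   singular. *)
have cf : {within SU `*` SV, continuous f}.
  apply: continuous_in_subspaceT => w; rewrite inE => -[/= /nzS w1 /nzS w2].
  rewrite /continuous_at /f /ratio; apply: cvgM; first exact: (continuous_expr cd).
  apply: cvgV; last exact: (continuous_expr cs).
  by rewrite expf_neq0 // gt_eqF // scatter_gt0.
(* The normalized identity is an invertible point of the sphere; it makes the domain nonempty and
   the maximum positive. *)
have normS m : (0 < m)%N -> exists2 w : 'rV[R]_(m * m),
    sqnorm (vec_mx w : 'M[R]_m) = 1 & (vec_mx w : 'M[R]_m) \in unitmx.
  move=> m0; have I0 : (1%:M : 'M[R]_m) != 0 by rewrite unitmx_neq0 ?unitmx1.
  exists (mxvec ((Num.sqrt (sqnorm (1%:M : 'M[R]_m)))^-1 *: 1%:M)); rewrite mxvecK.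
    exact: sqnorm_normalize.
  by rewrite unitmxZ ?unitmx1 // unitfE invr_eq0 sqrtr_eq0 -ltNge sqnorm_gt0.
have [wU wU1 wUu] := normS _ p_gt0; have [wV wV1 wVu] := normS _ q_gt0.
have A0 : (SU `*` SV) !=set0 by exists (wU, wV).
have cA : compact (SU `*` SV) by apply: compact_setX; exact: compact_sphere.
have [[u v]] := compact_EVT_max A0 cA cf.
rewrite inE => -[/= u1 v1] fmax; set U0 := vec_mx u in u1 *; set V0 := vec_mx v in v1 *.
have ratio_gt0 U V : U \in unitmx -> V \in unitmx -> 0 < ratio U V.
  move=> uU uV; rewrite divr_gt0 ?exprn_gt0 ?detpow_gt0 //.
  by rewrite scatter_gt0 ?unitmx_neq0.
have : 0 < ratio U0 V0.
  by apply: lt_le_trans (fmax (wU, wV) _); [exact: ratio_gt0|rewrite inE].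
(* A positive maximum excludes a singular maximizer: the exponents [q * n] and [p * n] are positive,
   so a zero determinant would annihilate [detpow]. *)
move=> r0; have d0 : detpow U0 V0 != 0.
  by apply: contraTneq r0; rewrite /ratio => ->; rewrite expr0n mul0r ltxx.
exists U0, V0; split.
- rewrite unitmxE unitfE; apply: contra d0 => /eqP dU.
  by rewrite /detpow dU normr0 expr0n muln_eq0 -!leqn0 leqNgt q_gt0 leqNgt n_gt0 mul0r.
- rewrite unitmxE unitfE; apply: contra d0 => /eqP dV.
  by rewrite /detpow dV normr0 expr0n muln_eq0 -!leqn0 leqNgt p_gt0 leqNgt n_gt0 mulr0.
move=> U V uU uV; have Un0 := unitmx_neq0 p_gt0 uU; have Vn0 := unitmx_neq0 q_gt0 uV.
have nz m (A : 'M[R]_m) : A != 0 -> (Num.sqrt (sqnorm A))^-1 != 0.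
  by move=> A0'; rewrite invr_eq0 sqrtr_eq0 -ltNge sqnorm_gt0.
(* Normalizing an arbitrary invertible pair moves it onto the spheres without changing its ratio. *)
rewrite -(ratioZ U V (nz _ _ Un0) (nz _ _ Vn0)).
have := fmax (mxvec ((Num.sqrt (sqnorm U))^-1 *: U), mxvec ((Num.sqrt (sqnorm V))^-1 *: V)).
rewrite /f /= !mxvecK; apply; rewrite inE.
by split; rewrite /SU /SV /= mxvecK sqnorm_normalize.
Qed.

End MaxRatio.

(** * Existence of the estimator for a spanning sample *)

Lemma mle_kron_exists (R : realType) (p q n : nat) (X : 'I_n -> 'M[R]_(p, q)) :
  (0 < p)%N -> (0 < q)%N -> (0 < n)%N ->
  (forall S : 'M[R]_(p, q),
    (forall k, \tr (S^T *m (X k - sample_mean X)) = 0) -> S = 0) ->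
  exists K : 'M[R]_(q * p), is_mle_kron X K.
Proof.
move=> p_gt0 q_gt0 n_gt0 X_span.
pose Y k := X k - sample_mean X; pose m := (p * q * n)%N.
have m_gt0 : (0 < m)%N by rewrite !muln_gt0 p_gt0 q_gt0.
have [U0 [V1 [uU0 uV1 ratio_le]]] := ratio_max p_gt0 q_gt0 X_span n_gt0.
have g1_gt0 : 0 < scatter Y U0 V1 by rewrite scatter_gt0 ?unitmx_neq0.
(* [scatter] is quadratic in [V], so this scale brings its value to [m]. *)
pose s := Num.sqrt (m%:R / scatter Y U0 V1).
have s_gt0 : 0 < s by rewrite sqrtr_gt0 divr_gt0 // ltr0n.
pose V0 := s *: V1.
have uV0 : V0 \in unitmx by rewrite unitmxZ // unitfE gt_eqF.
have g0 : scatter Y U0 V0 = m%:R.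
  rewrite -[U0]scale1r scatterZ mul1r sqr_sqrtr ?divfK ?gt_eqF //.
  by rewrite divr_ge0 ?ler0n // ltW.
have {}ratio_le U V : U \in unitmx -> V \in unitmx -> ratio Y U V <= ratio Y U0 V0.
  move=> uU uV; rewrite -[U0 in leRHS]scale1r ratioZ ?oner_eq0 ?gt_eqF //.
  exact: ratio_le.
exists (tensmx (invmx (V0^T *m V0)) (invmx (U0^T *m U0))).
exists (invmx (U0^T *m U0)), (invmx (V0^T *m V0)); split=> //;
  do ?exact: posdefmx_gram.
move=> M _ _ /posdefmx_factor[U uU ->] /posdefmx_factor[V uV ->].
rewrite !likelihood_gram // ler_wpM2l ?powR_ge0 //.
rewrite -/(detpow n U V) -/(detpow n U0 V0) -/(scatter Y U0 V0) g0.
(* First pass from [M] to the sample mean, with [U] and [V] fixed. *)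
apply: (@le_trans _ _ (detpow n U V * expR (- (1 / 2) * scatter Y U V))).
  apply: ler_wpM2l; first by rewrite ltW ?detpow_gt0.
  rewrite ler_expR !mulNr lerN2 ler_wpM2l //.
  exact: sample_mean_min.
have dge0 U' V' : 0 <= detpow n U' V' by rewrite mulr_ge0 ?exprn_ge0.
(* Squaring makes [detpow ^+ 2], the numerator of [ratio], appear and removes the factor 1/2 in the
   exponent. *)
rewrite -(@ler_pXn2r _ 2) ?nnegrE ?mulr_ge0 ?expR_ge0 //.
have sq x : expR (- (1 / 2) * x) ^+ 2 = expR (- x) :> R.
  by rewrite -expRM_natl; congr expR; lra.
rewrite (exprMn 2 (detpow n U V)) (exprMn 2 (detpow n U0 V0)) !sq; set g := scatter Y U V.
have g_gt0 : 0 < g by rewrite scatter_gt0 ?unitmx_neq0.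
have -> : detpow n U V ^+ 2 = ratio Y U V * g ^+ m.
  by rewrite divfK // expf_neq0 // gt_eqF.
have -> : detpow n U0 V0 ^+ 2 = ratio Y U0 V0 * m%:R ^+ m.
  by rewrite -[in m%:R ^+ m]g0 divfK // g0 expf_neq0 // pnatr_eq0 -lt0n.
(* Two independent comparisons remain: the ratios, and [g ^+ m * expR (- g)] against its value at
   [g = m]. *)
rewrite -(mulrA (ratio _ U V)) -(mulrA (ratio _ U0 V0)); apply: ler_pM.
- by apply: divr_ge0; [exact: sqr_ge0|exact: exprn_ge0 (ltW g_gt0)].
- by rewrite mulr_ge0 ?expR_ge0 ?exprn_ge0 // ltW.
- exact: ratio_le.
- by rewrite expR_power_le // ltW.
Qed.

(** * Null sets by slicing *)

Section NullSets.
Local Open Scope ereal_scope.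

(** Independence makes the joint law of [f1] and [f2] the product of their laws, whose value on [S]
    is the integral of the measures of its sections. *)
Lemma indep_section_null d d1 d2 (T : measurableType d) (T1 : measurableType d1)
    (T2 : measurableType d2) (R : realType) (P : probability T R)
    (f1 : T -> T1) (f2 : T -> T2) (S : set (T1 * T2)) :
  measurable_fun [set: T] f1 -> measurable_fun [set: T] f2 ->
  (forall A B, measurable A -> measurable B ->
    P (f1 @^-1` A `&` f2 @^-1` B) = P (f1 @^-1` A) * P (f2 @^-1` B)) ->
  measurable S -> (forall x, P (f2 @^-1` xsection S x) = 0) ->
  P [set t | S (f1 t, f2 t)] = 0.
Proof.
move=> mf1 mf2 indep mS S0.
have mf12 := measurable_fun_pair mf1 mf2.
pose F1 : {mfun T >-> T1} := mfun_Sub (mem_set mf1).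
pose F2 : {mfun T >-> T2} := mfun_Sub (mem_set mf2).
pose F12 : {mfun T >-> (T1 * T2)%type} := mfun_Sub (mem_set mf12).
have <- : (distribution P F1 \x distribution P F2) S = P [set t | S (f1 t, f2 t)].
  by rewrite (product_measure_unique (m' := distribution P F12)).
by rewrite /product_measure1 integral0_eq // => x _; exact: S0.
Qed.

(* The Gaussian density plays no role: any function supported on a proper affine
   subspace integrates to zero. *)
Lemma integral_cV_hyperplane (R : realType) (N : nat) (b : R) (c : 'rV[R]_N)
    (f : 'cV[R]_N -> \bar R) :
  (b != 0%R) || (c != 0%R) ->
  (forall v, (b + (c *m v) 0 0 != 0)%R -> f v = 0) ->
  integral_cV f = 0.
Proof.
elim: N b c f => [|m IH] b c f bc0 f0 /=.
  apply: f0; move: bc0; rewrite (thinmx0 c).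
  by rewrite eqxx orbF mul0mx mxE addr0.
move: c bc0 f0; change m.+1 with (1 + m)%N => c bc0 f0.
pose c1 := lsubmx c 0%R 0%R; pose c' := rsubmx c.
have cE : c = row_mx (c1%:M)%R c' by rewrite -mx11_scalar hsubmxK.
(* Fixing the first coordinate [x] leaves an affine form in the others with constant term
   [b + c1 * x]. *)
have inner x : (b + c1 * x != 0)%R || (c' != 0%R) ->
    integral_cV (fun v : 'cV[R]_m => f (col_mx (x%:M : 'M[R]_1) v)%R) = 0.
  move=> n0; apply: (IH _ _ _ n0) => v Hv; apply: f0; apply: contra Hv => /eqP <-.
  by rewrite cE mul_row_col -scalar_mxM [in eqbRHS]mxE [in eqbRHS]mxE eqxx mulr1n addrA.
have [c'0|c'0] := eqVneq c' 0%R; last first.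
  by apply: integral0_eq => x _; apply: inner; rewrite c'0 orbT.
have [c10|c10] := eqVneq c1 0%R.
  apply: integral0_eq => x _; apply: inner; rewrite c10 mul0r addr0.
  by move: bc0; rewrite cE c10 c'0 raddf0 row_mx0 eqxx orbF => ->.
have out x : ([set: R] `\ (- (b / c1)))%R x ->
    integral_cV (fun v : 'cV[R]_m => f (col_mx (x%:M : 'M[R]_1) v)%R) = 0.
  move=> -[_ /= /eqP xb]; apply: inner; apply/orP; left; apply: contra xb => /eqP H.
  have -> : x = ((b + c1 * x - b) / c1)%R by field.
  by rewrite H sub0r mulNr.
(* When only [c1] is a nonzero coefficient, the single abscissa [- (b / c1)] is exceptional, and
   Lebesgue measure ignores it. *)
rewrite -(@integral_setD1 _ _ (- (b / c1))%R).
- exact: integral0_eq.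
- exact: measurableD.
- apply: (eq_measurable_fun (cst 0)); last exact: measurable_cst.
  by move=> x; rewrite inE => /out ->.
Qed.
End NullSets.

(** * Measurability of entries and determinants *)

(** Naming the generators of [borel_mx] lets matrices carry the structure [g_sigma_algebraType],
    whose measurable sets are exactly those of [borel_mx]. *)
Definition entry_cylinders (R : realType) (p q : nat) : set_system 'M[R]_(p, q) :=
  [set A : set 'M[R]_(p, q) | exists (i : 'I_p) (j : 'I_q),
     exists2 B : set R, measurable B & A = [set M : 'M[R]_(p, q) | B (M i j)]].

Lemma measurable_entry (R : realType) (p q : nat) (i : 'I_p) (j : 'I_q) :
  measurable_fun [set: g_sigma_algebraType (@entry_cylinders R p q)]
    (fun M : 'M[R]_(p, q) => M i j).
Proof.
by move=> _ B mB; rewrite setTI; apply: sub_sigma_algebra; exists i, j, B.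
Qed.

Lemma measurable_det d (T : measurableType d) (R : realType) (m : nat)
    (F : T -> 'M[R]_m) :
  (forall i j, measurable_fun [set: T] (fun t => F t i j)) ->
  measurable_fun [set: T] (fun t => \det (F t)).
Proof.
move=> mF; apply: measurable_sum => s; apply: measurable_funM.
  exact: measurable_cst.
by apply: measurable_prod => i _; exact: mF.
Qed.

Lemma measurable_cofactor d (T : measurableType d) (R : realType) (m : nat)
    (F : T -> 'M[R]_m) (i j : 'I_m) :
  (forall i j, measurable_fun [set: T] (fun t => F t i j)) ->
  measurable_fun [set: T] (fun t => cofactor (F t) i j).
Proof.
move=> mF; apply: measurable_funM; first exact: measurable_cst.
by apply: measurable_det => a b; under eq_fun do rewrite !mxE; exact: mF.
Qed.

(** * Independence of one matrix from a family of others *)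

Section Past.
Context d (T : measurableType d) (R : realType) (P : probability T R).
Variables (n p q : nat) (X : 'I_n -> T -> 'M[R]_(p, q)).
Hypothesis X_random : forall k, random_mx (X k).
Hypothesis X_indep : independent_mx P X.

Lemma borel_mxT : borel_mx [set: 'M[R]_(p, q)].
Proof. exact: (@measurableT _ (g_sigma_algebraType (@entry_cylinders R p q))). Qed.

(* The rectangles generating the sigma-algebra of [(X k)_(k in J)]. *)
Definition past (J : {set 'I_n}) : set_system T :=
  [set A | exists2 B : 'I_n -> set 'M[R]_(p, q), forall k, borel_mx (B k) &
     A = \bigcap_(k in [set` J]) (X k @^-1` B k)].

Lemma past_setI (J : {set 'I_n}) : setI_closed (past J).
Proof.
move=> _ _ [B1 mB1 ->] [B2 mB2 ->]; exists (fun k => B1 k `&` B2 k).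
  move=> k; apply: (@measurableI _ (g_sigma_algebraType (@entry_cylinders R p q))).
    exact: mB1.
  exact: mB2.
by rewrite -bigcapI.
Qed.

Lemma past_measurable (J : {set 'I_n}) (A : set T) : <<s past J >> A -> measurable A.
Proof.
apply: smallest_sub; first exact: sigma_algebra_measurable.
move=> _ [B mB ->]; apply: fin_bigcap_measurable; first exact: finite_finset.
by move=> k _; exact: X_random.
Qed.

Lemma past_preimage (J : {set 'I_n}) (k : 'I_n) (B : set 'M[R]_(p, q)) :
  k \in J -> borel_mx B -> past J (X k @^-1` B).
Proof.
move=> kJ mB; exists (fun i => if i == k then B else setT) => [i|].
  by case: eqP => _ //; exact: borel_mxT.
apply/seteqP; split => [w Bw i _ /=|w /(_ k kJ)]; last by rewrite /= eqxx.
by case: eqP => // ->.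
Qed.

(** Both sides are finite measures in [A], so it suffices to compare them on the rectangles of
    [past J], a generating family closed under intersection; there the claim is independence over
    [k |: J]. *)
Lemma past_indep (J : {set 'I_n}) (k : 'I_n) (A : set T) (B : set 'M[R]_(p, q)) :
  k \notin J -> <<s past J >> A -> borel_mx B ->
  P (A `&` X k @^-1` B) = (P A * P (X k @^-1` B))%E.
Proof.
move=> kJ sA mB; set E := X k @^-1` B.
have mE : measurable E by exact: X_random.
pose r : {nonneg R} := NngNum (fine_ge0 (measure_ge0 P E)).
have rE : (r%:num)%:E = P E by rewrite fineK // fin_num_measure.
suff -> : P (A `&` E) = mscale r P A by rewrite /mscale /= rE muleC.
apply: (g_sigma_algebra_measure_unique (past J) _ (fun=> setT) _ _
  (mrestr P mE) (mscale r P)) sA => //.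
- by move=> C pC; apply: (@past_measurable J); exact: sub_sigma_algebra.
- move=> _; exists (fun=> setT); first by move=> ?; exact: borel_mxT.
  by apply/seteqP; split => // w _ i _.
- by rewrite bigcup_const //; exists 0%N.
- exact: past_setI.
- move=> _ [C mC ->]; set CJ := \bigcap_(i in _) _.
  change (P (CJ `&` E) = (r%:num)%:E * P CJ)%E; rewrite rE /CJ.
  (* [C'] adds the constraint [B] at [k] and agrees with [C] on [J], since [k] is not in [J]. *)
  pose C' i := if i == k then B else C i.
  have mC' i : borel_mx (C' i) by rewrite /C'; case: eqP.
  have CE i : i \in J -> C' i = C i.
    by rewrite /C'; case: eqP => // -> /(negP kJ).
  have := X_indep (k |: J) mC'; rewrite big_setU1 //= {2}/C' eqxx => H.
  rewrite (_ : _ `&` _ = \bigcap_(i in [set` k |: J]) X i @^-1` C' i).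
    rewrite H; congr (_ * _)%E.
    by rewrite X_indep //; apply: eq_bigr => i /CE ->.
  apply/seteqP; split => w /=.
    move=> [CJw Ew] i /=; rewrite in_setU1 => /orP[/eqP -> |iJ].
      by rewrite /C' eqxx.
    by rewrite CE //; exact: CJw.
  move=> H'; split => [i /= iJ|].
    by rewrite -(CE _ iJ); apply: H'; rewrite /= in_setU1 iJ orbT.
  by have := H' k; rewrite /= /C' eqxx in_setU1 eqxx; apply.
- by move=> _; rewrite /mrestr /= (le_lt_trans (probability_le1 P _)) ?ltry // setTI.
Qed.

End Past.

(** * Determinants of augmented matrices *)

(** Interpolates between the identity at [k = 0] and, at [k = 1 + N], the matrix testing affine
    independence of the [1 + N] points [x i]. *)
Definition augmented (R : realType) (N k : nat) (x : 'I_(1 + N) -> 'cV[R]_N) :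
    'M[R]_(1 + N) :=
  \matrix_(i, j) if (i < k)%N then row_mx 1%:M (x i)^T 0 j else (i == j)%:R.

Lemma det_augmented0 (R : realType) (N : nat) (x : 'I_(1 + N) -> 'cV[R]_N) :
  \det (augmented 0 x) = 1.
Proof.
rewrite (_ : augmented 0 x = 1%:M) ?det1 //.
by apply/matrixP => i j; rewrite !mxE.
Qed.

(** Row [k] is still a row of the identity. Hence a nonzero determinant provides a nonzero
    coefficient for the next affine form. *)
Lemma cofactor_augmented (R : realType) (N : nat) (x : 'I_(1 + N) -> 'cV[R]_N)
    (k : 'I_(1 + N)) :
  cofactor (augmented k x) k k = \det (augmented k x).
Proof.
rewrite (expand_det_row _ k) (bigD1 k) //= big1 => [|j jk].
  by rewrite mxE ltnn eqxx mul1r addr0.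
by rewrite mxE ltnn eq_sym (negPf jk) mul0r.
Qed.

(** The two matrices differ only in row [k], so they share the cofactors along it, and these depend
    only on the earlier vectors. *)
Lemma det_augmentedS (R : realType) (N : nat) (x : 'I_(1 + N) -> 'cV[R]_N)
    (k : 'I_(1 + N)) :
  \det (augmented k.+1 x) =
  \sum_j row_mx 1%:M (x k)^T 0 j * cofactor (augmented k x) k j.
Proof.
rewrite (expand_det_row _ k); apply: eq_bigr => j _.
rewrite mxE ltnSn /cofactor; congr (_ * (_ * \det _)).
apply/matrixP => a b; rewrite !mxE ltnS leq_eqVlt.
by rewrite -[nat_of_ord (lift k a) == k]/(lift k a == k) eq_sym (negPf (neq_lift k a)).
Qed.

Lemma hyperplane_formE (R : realType) (N : nat) (C : 'I_(1 + N) -> R) (v : 'cV[R]_N) :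
  \sum_j row_mx 1%:M v^T 0 j * C j =
  C (lshift N 0) + ((\row_j C (rshift 1 j)) *m v) 0 0.
Proof.
rewrite big_split_ord /= big_ord1 row_mxEl mxE eqxx mul1r mxE; congr (_ + _).
by apply: eq_bigr => j _; rewrite row_mxEr !mxE mulrC.
Qed.

(** The zero set of the form is Borel, and the density times its indicator vanishes off that set, so
    [integral_cV_hyperplane] applies. *)
Lemma normal_hyperplane_null d (T : measurableType d) (R : realType)
    (P : probability T R) (N : nat) (Y : T -> 'cV[R]_N) (mu : 'cV[R]_N)
    (Sigma : 'M[R]_N) (C : 'I_(1 + N) -> R) (k : 'I_(1 + N)) :
  multivariate_normal P Y mu Sigma -> C k != 0 ->
  P [set w | \sum_j row_mx 1%:M (Y w)^T 0 j * C j = 0] = 0%E.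
Proof.
move=> [_ YN] Ck0; pose h v := \sum_j row_mx 1%:M v^T 0 j * C j.
have mh : measurable_fun [set: g_sigma_algebraType (@entry_cylinders R N 1)]
    (h : 'cV[R]_N -> R).
  apply: measurable_sum => j; apply: measurable_funM; last exact: measurable_cst.
  case: (split_ordP j) => i ->.
    by under eq_fun do rewrite row_mxEl; exact: measurable_cst.
  under eq_fun do rewrite row_mxEr mxE; exact: measurable_entry.
have mH : borel_mx (h @^-1` [set 0]).
  by have := mh measurableT _ (measurable_set1 0); rewrite setTI.
rewrite -[LHS]/(P (Y @^-1` (h @^-1` [set 0]))) YN //.
apply: (@integral_cV_hyperplane _ _ (C (lshift N 0)) (\row_j C (rshift 1 j))).
  case: (split_ordP k) Ck0 => i ->; first by rewrite (ord1 i) => ->.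
  move=> Ci0; apply/orP; right; apply: contra Ci0 => /eqP /rowP /(_ i).
  by rewrite !mxE => ->.
move=> v; rewrite -hyperplane_formE -/(h v) => hv.
by rewrite indicE memNset ?mulr0 // => /eqP; rewrite (negPf hv).
Qed.

Lemma tr_vec (R : realType) (p q : nat) (A B : 'M[R]_(p, q)) :
  \tr (A^T *m B) = ((vec A)^T *m vec B) 0 0.
Proof.
rewrite mxE /mxtrace; under eq_bigr do rewrite mxE.
rewrite pair_big (reindex (@mxtens_unindex q p)) /=.
  by apply: eq_bigr => k _; rewrite !mxE.
by exists (@mxtens_index q p) => k _; rewrite (mxtens_indexK, mxtens_unindexK).
Qed.

Lemma augmented_span (R : realType) (p q n : nat) (X : 'I_n -> 'M[R]_(p, q))
    (f : 'I_(1 + q * p) -> 'I_n) :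
  \det (augmented (1 + q * p) (fun i => vec (X (f i)))) != 0 ->
  forall S : 'M[R]_(p, q),
    (forall k, \tr (S^T *m (X k - sample_mean X)) = 0) -> S = 0.
Proof.
set A := augmented _ _ => dA S SX.
have uA : A \in unitmx by rewrite unitmxE unitfE.
pose b := \tr (S^T *m sample_mean X).
have SXb k : \tr (S^T *m X k) = b.
  by apply/eqP; rewrite -subr_eq0 -raddfB /= -mulmxBr SX.
(* Orthogonality to the deviations gives all [X k] the same inner product [b] with [S]; so every row
   [(1, vec X_k)] annihilates [(- b, vec S)]. *)
have : A *m col_mx (- b)%:M (vec S) = 0.
  apply/matrixP => i j; rewrite (ord1 j) {j} !mxE.
  under eq_bigr do rewrite mxE ltn_ord.
  rewrite big_split_ord /= big_ord1 row_mxEl col_mxEu !mxE eqxx mul1r.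
  under eq_bigr do rewrite row_mxEr col_mxEd mxE.
  rewrite -[b](SXb (f i)) tr_vec mxE; under [X in _ + X]eq_bigr do rewrite mulrC.
  by apply/eqP; rewrite addrC subr_eq0; apply/eqP/eq_bigr => j _; rewrite [in RHS]mxE.
move/(congr1 (mulmx (invmx A))); rewrite mulKmx // mulmx0 => /eqP.
rewrite col_mx_eq0 => /andP[_ /eqP S0].
apply/matrixP => i j; have /matrixP /(_ (@mxtens_index q p (j, i)) 0) := S0.
by rewrite !mxE mxtens_indexK.
Qed.

(** * Almost sure nonvanishing of the determinant *)

Section AlmostSure.
Context d (T : measurableType d) (R : realType) (P : probability T R).
Variables (n p q : nat) (X : 'I_n -> T -> 'M[R]_(p, q)).
Variables (mu : 'cV[R]_(q * p)) (Sigma : 'M[R]_(q * p)).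
Hypothesis X_random : forall k, random_mx (X k).
Hypothesis X_indep : independent_mx P X.
Hypothesis X_normal : forall k,
  multivariate_normal P (fun w => vec (X k w)) mu Sigma.
Variable f : 'I_(1 + q * p) -> 'I_n.
Hypothesis f_inj : injective f.

Let D k w := augmented k (fun i => vec (X (f i) w)).

Lemma det_augmented_step (k : 'I_(1 + q * p)) :
  P.-negligible [set w | \det (D k w) != 0 /\ \det (D k.+1 w) = 0].
Proof.
pose J := [set f i | i : 'I_(1 + q * p) in [pred i : 'I_(1 + q * p) | (i < k)%N]].
have fkJ : f k \notin J.
  by apply/imsetP => -[i]; rewrite inE => /[swap] /f_inj <-; rewrite ltnn.
(* The past is encoded as the identity map from [T] to the same set with the coarser sigma-algebra
   of the earlier matrices. *)
pose T1 := g_sigma_algebraType (past X J).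
pose T2 := g_sigma_algebraType (@entry_cylinders R p q).
have mD i j : measurable_fun [set: T1] (fun w => D k w i j).
  rewrite /D /augmented; under eq_fun do rewrite mxE.
  case: (boolP (i < k)%N) => ik; last exact: measurable_cst.
  case: (split_ordP j) => l ->.
    by under eq_fun do rewrite row_mxEl; exact: measurable_cst.
  under eq_fun do rewrite row_mxEr !mxE.
  move=> _ B mB; rewrite setTI; apply: sub_sigma_algebra.
  apply: (@past_preimage _ _ _ _ _ _ X J (f i)
    [set M | B (M (mxtens_unindex l).2 (mxtens_unindex l).1)]).
    by apply/imsetP; exists i.
  by apply: sub_sigma_algebra; do 2 eexists; exists B.
(* The next determinant, with the past and the new matrix as separate variables. *)
pose g (z : T1 * T2) := \sum_j row_mx 1%:M (vec z.2)^T 0 j * cofactor (D k z.1) k j.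
have mg : measurable_fun [set: T1 * T2] g.
  apply: measurable_sum => j; apply: measurable_funM.
    case: (split_ordP j) => l ->.
      by under eq_fun do rewrite row_mxEl; exact: measurable_cst.
    under eq_fun do rewrite row_mxEr !mxE.
    exact: (measurableT_comp (measurable_entry _ _) measurable_snd).
  exact: (measurableT_comp (measurable_cofactor k j mD) measurable_fst).
pose S := [set z : T1 * T2 | \det (D k z.1) != 0 /\ g z = 0].
have mS : measurable S.
  have md : measurable_fun [set: T1 * T2] (fun z => \det (D k z.1)).
    exact: (measurableT_comp (measurable_det mD) measurable_fst).
  have -> : S = ((fun z => \det (D k z.1)) @^-1` (~` [set 0])) `&` (g @^-1` [set 0]).
    by apply/seteqP; split => z /= -[dz gz]; split => //; exact/eqP.
  apply: measurableI; rewrite -[X in measurable X]setTI.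
    by apply: md => //; exact: measurableC.
  exact: mg.
have mid : measurable_fun [set: T] (id : T -> T1).
  by move=> _ A mA; rewrite setTI; exact: (past_measurable X_random mA).
have mX : measurable_fun [set: T] (X (f k) : T -> T2).
  by move=> _ A mA; rewrite setTI; exact: X_random.
exists [set w | S (w, X (f k) w)]; split.
- rewrite -[X in measurable X]setTI.
  exact: (measurable_fun_pair mid mX).
- apply: (indep_section_null mid mX) => // [A B mA mB|w].
    exact: (past_indep X_random X_indep fkJ).
  (* The section at [w] is empty if the current determinant vanishes; otherwise it is the zero set
     of an affine form whose coefficient [k] is that determinant. *)
  have [dw|dw] := eqVneq (\det (D k w)) 0.
    rewrite (_ : _ @^-1` _ = set0) ?measure0 // -subset0 => t.
    by move=> /xsectionP[/=]; rewrite dw eqxx.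
  rewrite (_ : _ @^-1` _ = [set t | \sum_j row_mx 1%:M (vec (X (f k) t))^T 0 j *
      cofactor (D k w) k j = 0]).
    by apply: (normal_hyperplane_null (k := k) (X_normal (f k))); rewrite cofactor_augmented.
  by apply/seteqP; split => t; [move/xsectionP => -[]|move=> ?; apply/xsectionP].
- by move=> w [dw]; rewrite det_augmentedS; split.
Qed.

Lemma det_augmented_ae (m : nat) : (m <= 1 + q * p)%N ->
  {ae P, forall w, \det (D m w) != 0}.
Proof.
elim: m => [_|m IH mN]; first by apply: aeW => w; rewrite det_augmented0 oner_neq0.
have [A [mA PA0 HA]] := det_augmented_step (Ordinal mN).
have nA : {ae P, forall w, ~ A w} by exists A; split => // w /= /contrapT.
apply: filterS2 (IH (ltnW mN)) nA => w dm Aw; apply/negP => /eqP dS.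
by apply: Aw; apply: HA.
Qed.

End AlmostSure.

Theorem theorem3 (R : realType) (d : measure_display) (T : measurableType d)
    (P : probability T R) (p q n : nat)
    (p_gt0 : (0 < p)%N) (q_gt0 : (0 < q)%N) (n_gt0 : (0 < n)%N)
    (mu : 'cV[R]_(q * p)) (Gamma : 'M[R]_p) (Psi : 'M[R]_q)
    (Gamma_pd : posdefmx Gamma) (Psi_pd : posdefmx Psi)
    (X : 'I_n -> T -> 'M[R]_(p, q))
    (X_random : forall k, random_mx (X k))
    (X_indep : independent_mx P X)
    (X_normal : forall k,
       multivariate_normal P (fun w => vec (X k w)) mu (tensmx Psi Gamma))
    (n_gt_pq : (p * q < n)%N) :
  {ae P, forall w : T,
    exists K : 'M[R]_(q * p), is_mle_kron (fun k => X k w) K}.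
Proof.
(* The sample size leaves room for [1 + q * p] matrices; the first ones are used. *)
have qp_lt : (1 + q * p <= n)%N by rewrite mulnC.
have f_inj : injective (widen_ord qp_lt).
  by move=> i j /(congr1 val) /= ij; exact: val_inj.
apply: filterS (det_augmented_ae X_random X_indep X_normal f_inj (leqnn _)) => w dw.
by apply: mle_kron_exists => //; exact: augmented_span dw.
Qed.
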